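(* Let $x^+$ be the positive sample, $x^{\rm label}$ the anchor (label) and $s\in\mathbb{R}^n$ the unobserved latent variable, generated by $x^+=F(s,x^{\rm label})+\epsilon$ with $F$ a reversible injective function and $\epsilon$ an independent noise variable, and let $p(x^+\mid x^{\rm label},s)$ be the corresponding (fixed, environment-independent) conditional distribution. Let $$\mathcal{D}=\Big\{p(x^+,x^{\rm label},s)=p(x^+\mid x^{\rm label},s)\,p(x^{\rm label})\,p(s\mid x^{\rm label})\ \Big|\ p(x^{\rm label})>0,\ p(s\mid x^{\rm label})>0\Big\}$$ be the set of environments $e$ (with joint distribution denoted $p^e$), and let $\mathrm{PID}$ be the family of those $e$ for which $p^e(x^+,x^{\rm label},s)=p(x^+\mid x^{\rm label},s)\,p^e(x^{\rm label})\,p^e(s)$. For a model $f$, which defines a conditional distribution $p_f(x^{\rm label}\mid x^+)$, define the risk in environment $e$ by $$\mathcal{L}^e(f)=\mathcal{L}^e(p_f(x^{\rm label}\mid x^+))=\mathbb{E}_{p^e(x^+,x^{\rm label})}\big[-\log p_f(x^{\rm label}\mid x^+)\big],$$ where $p^e(x^+,x^{\rm label})$ is the joint distribution of $(x^+,x^{\rm label})$ in environment $e$. Assume that there exist functions $F_{x^{\rm label}}$, $F_s$ and noise variables $\epsilon_{x^{\rm label}}$, $\epsilon_s$ such that $$(x^{\rm label},s)=F^{-1}(x^+-\epsilon)=\big(F_{x^{\rm label}}(x^+-\epsilon_{x^{\rm label}}),\ F_s(x^+-\epsilon_s)\big).$$ If $f^*=\arg\min_f\mathcal{L}^e(f)$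 for all $e\in\mathrm{PID}$, then $f^*$ is minimax optimal across all environments in $\mathcal{D}$, that is, $$f^*=\arg\min_f\ \max_{e\in\mathcal{D}}\ \mathcal{L}^e\big(p_f(x^{\rm label}\mid x^+)\big).$$
   Context: Setting: a mini-batch in self-supervised learning is viewed as a multi-class classification task. It consists of pairs $(x^+,x^{\rm label})$, where the anchor $x^{\rm label}$ plays the role of the class label (the classes being the finitely many anchors) and $x^+$ is the other sample of the pair. Each $e\in\mathcal{D}$ is an environment, i.e. a joint distribution of $(x^+,x^{\rm label},s)$; all environments share the same causal mechanism $p(x^+\mid x^{\rm label},s)$, while $p^e(x^{\rm label})$ and $p^e(s\mid x^{\rm label})$ may vary. Post-intervention distribution (PID): a distribution of the form $p(x^+,x^{\rm label},s)=p(x^+\mid x^{\rm label},s)\,p(x^{\rm label})\,p(s)$, so that $x^{\rm label}$ and $s$ are independent. The PID family is regarded as a subfamily of $\mathcal{D}$ with the same mechanism $p(x^+\mid x^{\rm label},s)$. The invertibility assumption in the claim is understood (as stated in the paper) to imply that $x^{\rm label}$ and $s$ are conditionally independent given $x^+$ under PID distributions. The minimizations over $f$ are over all models, each identified with its conditional distribution $p_f(x^{\rm label}\mid x^+)$, with no restriction on the model class; $f^*=\arg\min$ means that $f^*$ attains the minimum. *)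

(* Defs.v *)
From HB Require Import structures.
From mathcomp Require Import all_boot all_order all_algebra.
From mathcomp Require Import all_classical all_reals all_analysis.

Set Implicit Arguments.
Unset Strict Implicit.
Unset Printing Implicit Defensive.
Import Order.TTheory GRing.Theory Num.Theory.
Local Open Scope classical_set_scope.
Local Open Scope ring_scope.

(* R^m is [m.-tuple R], with the product (Borel) sigma-algebra. *)
Definition vadd (R : realType) m (u v : m.-tuple R) : m.-tuple R :=
  [tuple tnth u i + tnth v i | i < m].
Definition vsub (R : realType) m (u v : m.-tuple R) : m.-tuple R :=
  [tuple tnth u i - tnth v i | i < m].

Section lebesgue.
Context (R : realType).

Definition vcons m (p : measurableTypeR R * m.-tuple R) : m.+1.-tuple R :=
  [tuple of p.1 :: p.2].

Lemma measurable_vcons m :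
  measurable_fun [set: measurableTypeR R * m.-tuple R] (@vcons m).
Proof.
exact: (@measurable_cons _ _ (measurableTypeR R * m.-tuple R)%type R
  fst m snd measurable_fst measurable_snd).
Qed.

Section lebesgue_vcons.
Local Open Scope ereal_scope.
Context m (mu : {measure set (m.-tuple R) -> \bar R}).

Definition lebesgue_vcons : set (m.+1.-tuple R) -> \bar R :=
  pushforward (lebesgue_measure \x^ mu) (@vcons m).

Let lebesgue_vcons0 : lebesgue_vcons set0 = 0.
Proof. by rewrite /lebesgue_vcons /pushforward preimage_set0 measure0. Qed.

Let lebesgue_vcons_ge0 A : 0 <= lebesgue_vcons A.
Proof. by rewrite /lebesgue_vcons /pushforward; exact: measure_ge0. Qed.

Let lebesgue_vcons_sigma_additive : semi_sigma_additive lebesgue_vcons.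
Proof.
have mv := @measurable_vcons m.
move=> F mF tF mUF; rewrite /lebesgue_vcons /pushforward preimage_bigcup.
apply: measure_semi_sigma_additive.
- by move=> k; rewrite -[X in measurable X]setTI; exact: mv.
- apply/trivIsetP => i j _ _ ij; rewrite -preimage_setI.
  by move/trivIsetP : tF => /(_ _ _ _ _ ij) ->//; rewrite preimage_set0.
- by rewrite -preimage_bigcup -[X in measurable X]setTI; exact: mv.
Qed.

HB.instance Definition _ := isMeasure.Build _ _ _ lebesgue_vcons
  lebesgue_vcons0 lebesgue_vcons_ge0 lebesgue_vcons_sigma_additive.

End lebesgue_vcons.

(* Lebesgue measure on R^m: the image of lambda_1 (x) lambda_m under vcons. *)
Fixpoint lebesgue_tuple (m : nat) : {measure set (m.-tuple R) -> \bar R} :=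
  match m with
  | 0 => \d_([tuple])
  | m.+1 => lebesgue_vcons (lebesgue_tuple m)
  end.

End lebesgue.

Section conditional_independence.
Context d dX dU dV (T : measurableType d) (X : measurableType dX)
  (U : measurableType dU) (V : measurableType dV) (R : realType).
Implicit Types (P : probability T R) (x : T -> X).

(* [g] is a version of the conditional probability P(E | x = .). *)
Definition cond_prob_version P x (E : set T) (g : X -> R) : Prop :=
  [/\ measurable_fun [set: X] g, forall a, 0 <= g a &
      forall A, measurable A ->
        P (E `&` x @^-1` A) = (\int[P]_(w in x @^-1` A) (g (x w))%:E)%E].

Definition cond_indep P (u : T -> U) (v : T -> V) x : Prop :=
  forall B C, measurable B -> measurable C ->
  exists g h : X -> R,
    [/\ cond_prob_version P x (u @^-1` B) g,
        cond_prob_version P x (v @^-1` C) h &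
        cond_prob_version P x (u @^-1` B `&` v @^-1` C) (fun a => g a * h a)].

End conditional_independence.

Section environments.
Context (R : realType) (d n : nat) (dK dO : measure_display)
  (K : measurableType dK) (O : measurableType dO).

Local Notation X := (d.-tuple R).
Local Notation S := (n.-tuple R).

(* Points of the space carrying the joint distributions: ((x+, xlabel), s). *)
Local Notation joint := (X * K * S)%type.

(* The conditional distribution p(x+ | xlabel, s) of x+ = F(xlabel, s) + eps,
   with eps of law [distribution Q eps] independent of (xlabel, s). *)
Definition mechanism (F : {mfun (K * S)%type >-> X}) (Q : probability O R)
    (eps : {RV Q >-> X}) (ys : K * S) : set X -> \bar R :=
  pushforward Q (fun w => vadd (F ys) (eps w)).

Implicit Types (mech : K * S -> set X -> \bar R) (P : probability joint R).

Definition positive_density (q : S -> R) : Prop :=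
  [/\ measurable_fun [set: S] q, forall s, 0 < q s &
      (\int[lebesgue_tuple R n]_s (q s)%:E = 1)%E].

(* P = p(x+ | xlabel, s) p(xlabel) q(s | xlabel); the labels being finitely
   many, P is determined by its values on these rectangles. *)
Definition factorizes mech (p : K -> R) (q : K -> S -> R) P : Prop :=
  forall (A : set X) (y : K) (B : set S), measurable A -> measurable B ->
  P (A `*` [set y] `*` B) =
  ((p y)%:E * \int[lebesgue_tuple R n]_(s in B) (mech (y, s) A * (q y s)%:E))%E.

Definition env mech : set (probability joint R) :=
  [set P | exists (p : K -> R) (q : K -> S -> R),
    [/\ forall y, 0 < p y, forall y, positive_density (q y) &
        factorizes mech p q P]].

Definition PID mech : set (probability joint R) :=
  [set P | exists (p : K -> R) (r : S -> R),
    [/\ forall y, 0 < p y, positive_density r &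
        factorizes mech p (fun=> r) P]].

Lemma PID_env mech : PID mech `<=` env mech.
Proof. by move=> P [p [r [p0 r0 Pf]]]; exists p, (fun=> r). Qed.

(* A model is the conditional distribution x |-> p_f(. | x); the risk takes its
   values in [0, +oo], with - log 0 = +oo. *)
Definition risk P (f : R.-pker X ~> K) : \bar R :=
  (\int[pushforward P fst]_z - lne (f z.1 [set z.2]))%E.

Definition risk_argmin P (f : R.-pker X ~> K) : Prop :=
  forall g, (risk P f <= risk P g)%E.

Definition worst_risk (D : set (probability joint R)) (f : R.-pker X ~> K) :
  \bar R := ereal_sup [set risk P f | P in D].

Definition minimax_optimal (D : set (probability joint R))
    (f : R.-pker X ~> K) : Prop :=
  forall g, (worst_risk D f <= worst_risk D g)%E.

(* The last clause is part of the assumption: taken alone, the decomposition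
   holds for any injective F, with eps_y = eps_s = eps. *)
Definition invertible_mechanism (F : {mfun (K * S)%type >-> X})
    (Finv : X -> K * S) (Q : probability O R) (eps : {RV Q >-> X}) : Prop :=
  (exists (Fy : X -> K) (Fs : X -> S) (eps_y eps_s : {RV Q >-> X}),
     forall (y : K) (s : S), {ae Q, forall w,
       let x := vadd (F (y, s)) (eps w) in
       (y, s) = Finv (vsub x (eps w)) /\
       Finv (vsub x (eps w)) = (Fy (vsub x (eps_y w)), Fs (vsub x (eps_s w)))})
  /\
  (forall P : probability joint R, PID (mechanism F eps) P ->
     cond_indep P (fun w => w.1.2) (fun w => w.2) (fun w => w.1.1)).

End environments.

(* Main.v *)
(* Optimality on the whole PID family forces zero loss. Take an environment with
   weights p and densities q, a label y, and the PID with density q(. | y) and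
   label weights p' almost concentrated at y. There the model that ignores x+ and
   always predicts the law p' of the label has risk the entropy H(p'), so the
   share of the label y in the risk of the optimal model is at most H(p'). That
   share is p'(y) / p(y) times its share in the original environment, and H(p')
   tends to 0 as p' concentrates at y; hence each label contributes 0 to the risk
   in the original environment, and the worst-case risk of the model is 0. *)
Require Import Defs.
From HB Require Import structures.
From mathcomp Require Import all_boot all_order all_algebra.
From mathcomp Require Import all_classical all_reals all_analysis.
From mathcomp Require Import measurable_realfun ring lra.

Set Implicit Arguments.
Unset Strict Implicit.
Unset Printing Implicit Defensive.
Import Order.TTheory GRing.Theory Num.Theory.
Local Open Scope classical_set_scope.
Local Open Scope ring_scope.

(** * Integration against a measure given by a density *)

Section density.
Local Open Scope ereal_scope.
Import HBNNSimple.

(** The hypothesis on [mu] and [nu] is the case of indicator functions; linearity extends it to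
    simple functions and monotone convergence to all nonnegative [f]. The set [D] allows the
    restriction to a label event before projecting to the latent variable. *)
Lemma ge0_integral_pushforward_density d1 d2 (T1 : measurableType d1)
    (T2 : measurableType d2) (R : realType) (phi : T1 -> T2)
    (mu : {measure set T1 -> \bar R}) (nu : {measure set T2 -> \bar R})
    (D : set T1) (g f : T2 -> \bar R) (E : set T2) :
    measurable_fun setT phi -> measurable D ->
    measurable_fun setT g -> (forall x, 0 <= g x) ->
    (forall x, g x \is a fin_num) ->
    (forall B, measurable B -> mu (D `&` phi @^-1` B) = \int[nu]_(x in B) g x) ->
    measurable_fun setT f -> (forall x, 0 <= f x) -> measurable E ->
  \int[mu]_(x in D `&` phi @^-1` E) f (phi x) = \int[nu]_(x in E) (f x * g x).
Proof.
move=> mphi mD mg g0 gfin muE mf0 f0 mE.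
have mf : measurable_fun E f by exact: measurable_funTS.
have mDE B : measurable B -> measurable (D `&` phi @^-1` B).
  by move=> mB; apply: measurableI => //; rewrite -[X in measurable X]setTI; exact: mphi.
have mind A : measurable A -> measurable_fun setT (fun x => \1_A (phi x) : R).
  by move=> mA; exact: (measurableT_comp (measurable_indic mA) mphi).
pose h := nnsfun_approx mE mf.
have -> : \int[mu]_(x in D `&` phi @^-1` E) f (phi x) =
    limn (fun n => \int[mu]_(x in D `&` phi @^-1` E) (h n (phi x))%:E).
  rewrite -monotone_convergence//.
  - apply: eq_integral => x /[!inE] -[_ Ex]; apply/esym/cvg_lim => //.
    exact: cvg_nnsfun_approx.
  - exact: mDE.
  - move=> n; apply: measurable_funTS; apply/measurable_EFinP.
    exact: measurableT_comp.
  - by move=> n x _; rewrite lee_fin.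
  - by move=> x _ a b ab; rewrite lee_fin; exact/lefP/nd_nnsfun_approx.
have -> : \int[nu]_(x in E) (f x * g x) =
    limn (fun n => \int[nu]_(x in E) ((h n x)%:E * g x)).
  rewrite -monotone_convergence//.
  - apply: eq_integral => x /[!inE] Ex; apply/esym/cvg_lim => //.
    by apply: cvgeZr => //; exact: cvg_nnsfun_approx.
  - move=> n; apply: emeasurable_funM; apply: measurable_funTS => //.
    exact/measurable_EFinP.
  - by move=> n x _; rewrite mule_ge0 ?lee_fin.
  - move=> x _ a b ab; rewrite lee_wpmul2r//.
    by rewrite lee_fin; exact/lefP/nd_nnsfun_approx.
congr (limn _); apply/funext => n.
(* Both sides are expanded over the finitely many values of the simple function [h n], and then
   compared level set by level set. *)
transitivity (\sum_(k \in range (h n))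
    \int[mu]_(x in D `&` phi @^-1` E) (k * \1_((h n @^-1` [set k])) (phi x))%:E).
  under eq_integral do rewrite fimfunE -fsumEFin//.
  rewrite ge0_integral_fsum//.
  - exact: mDE.
  - move=> y; apply: measurable_funTS; apply/measurable_EFinP/measurable_funM => //.
    exact: mind.
  - by move=> y x _; rewrite nnfun_muleindic_ge0.
transitivity (\sum_(k \in range (h n))
    \int[nu]_(x in E) ((k * \1_((h n @^-1` [set k])) x)%:E * g x)); last first.
  rewrite -ge0_integral_fsum//.
  - apply: eq_integral => x _.
    rewrite -ge0_mule_fsuml => [|y]; last exact: nnfun_muleindic_ge0.
    by rewrite fsumEFin// -fimfunE.
  - move=> y; apply: emeasurable_funM; apply: measurable_funTS => //.
    exact/measurable_EFinP/measurable_funM.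
  - by move=> y x _; rewrite mule_ge0 ?nnfun_muleindic_ge0.
apply: eq_fsbigr => r rh.
have r0 : (0 <= r)%R by move: rh; rewrite inE => -[x _ <-].
set A := h n @^-1` [set r].
have mA : measurable A by rewrite /A.
under eq_integral do rewrite EFinM.
rewrite ge0_integralZl_EFin//; last 2 first.
  - exact: mDE.
  - by apply: measurable_funTS; apply/measurable_EFinP; exact: mind.
under [RHS]eq_integral do rewrite EFinM -muleA.
rewrite ge0_integralZl_EFin//; last 2 first.
  - by move=> x _; rewrite mule_ge0 ?lee_fin.
  - apply: emeasurable_funM; apply: measurable_funTS => //.
    exact/measurable_EFinP/measurable_indic.
congr (_ * _).
transitivity (\int[mu]_(x in D `&` phi @^-1` E) (\1_(phi @^-1` A) x)%:E) => //.
rewrite integral_indic//; last 2 first.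
- exact: mDE.
- by rewrite -[X in measurable X]setTI; exact: mphi.
rewrite (_ : _ `&` _ = D `&` phi @^-1` (E `&` A)); last first.
  by rewrite preimage_setI setIC setIA.
rewrite muE; last exact: measurableI.
rewrite integral_mkcondr; apply: eq_integral => x _.
by rewrite patchE indicE; case: ifPn; rewrite ?mul1e ?mul0e.
Qed.

Lemma density_probability d (T : measurableType d) (R : realType)
    (mu : {measure set T -> \bar R}) (h : T -> \bar R) :
    measurable_fun setT h -> (forall x, 0 <= h x) -> \int[mu]_x h x = 1 ->
  exists P : probability T R, forall A, P A = \int[mu]_(x in A) h x.
Proof.
move=> mh h0 h1; pose m A := \int[mu]_(x in A) h x.
have m0 : m set0 = 0 by exact: integral_set0.
have m_ge0 A : 0 <= m A by exact: integral_ge0.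
have m_sigma : semi_sigma_additive m by exact: semi_sigma_additive_nng_induced.
pose mM := isMeasure.Build _ _ _ m m0 m_ge0 m_sigma.
pose mm : {measure set T -> \bar R} := HB.pack m mM.
pose mP := Measure_isProbability.Build _ _ _ mm h1.
by exists (HB.pack_for (probability T R) m mm mP).
Qed.

End density.

(** * Measurability of the logarithm and of functions chosen by the label *)

Lemma measurable_lne (R : realType) : measurable_fun setT (@lne R).
Proof.
have -> : @lne R = fun x => if (x <= 0)%E then -oo%E else
    if x == +oo%E then +oo%E else (ln (fine x))%:E.
  by apply/funext => -[r| |] /=; rewrite ?lee_fin ?leye_eq ?leNye ?eqxx.
apply: measurable_fun_ifT => //.
  exact: measurable_fun_lee.
apply: measurable_fun_ifT => //.
  exact: measurable_fun_eqe.
exact/measurable_EFinP/measurableT_comp.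
Qed.

Section finite_labels.
Context d d1 d2 (T : measurableType d) (K : measurableType d1)
  (Y : measurableType d2).
Hypotheses (K_finite : finite_set [set: K])
  (K_discrete : forall A : set K, measurable A).

(** A preimage splits, according to the value of [k], into finitely many measurable pieces. Joint
    measurability of the loss and of the density ratio thus reduces to a fixed label. *)
Lemma measurable_fun_finite_choice (k : T -> K) (F : K -> T -> Y) :
  measurable_fun setT k -> (forall y, measurable_fun setT (F y)) ->
  measurable_fun setT (fun t => F (k t) t).
Proof.
move=> mk mF _ B mB; rewrite setTI.
have -> : (fun t => F (k t) t) @^-1` B =
    \bigcup_(y in setT) (k @^-1` [set y] `&` F y @^-1` B).
  apply/seteqP; split => [t Bt|t [y _ [/= -> //]]].
  by exists (k t).
apply: fin_bigcup_measurable => // y _; apply: measurableI.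
  by rewrite -[X in measurable X]setTI; exact: mk.
by rewrite -[X in measurable X]setTI; exact: mF.
Qed.

End finite_labels.

(** * The conditional law of the positive sample *)

Section mechanism.
Context (R : realType) (d n : nat) (dK dO : measure_display)
  (K : measurableType dK) (O : measurableType dO) (Q : probability O R)
  (eps : {RV Q >-> d.-tuple R}) (F : {mfun (K * n.-tuple R)%type >-> d.-tuple R}).

Local Notation X := (d.-tuple R).
Local Notation S := (n.-tuple R).
Local Notation joint := (X * K * S)%type.
Local Notation M := (mechanism F eps).

Lemma measurable_vadd : measurable_fun [set: X * X] (fun z => vadd z.1 z.2).
Proof.
apply/measurable_fun_tnthP => i.
rewrite (_ : _ \o _ = fun z : X * X => tnth z.1 i + tnth z.2 i); last first.
  by apply/funext => z /=; rewrite tnth_mktuple.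
by apply: measurable_funD; apply: (measurableT_comp (measurable_tnth i)).
Qed.

Lemma measurable_noisy :
  measurable_fun [set: (K * S) * O] (fun z => vadd (F z.1) (eps z.2)).
Proof.
apply: (measurableT_comp measurable_vadd (f := fun z => vadd z.1 z.2)
  (g := fun z : (K * S) * O => (F z.1, eps z.2))).
by apply/measurable_fun_pair; apply: measurableT_comp.
Qed.

Lemma mechanism_ge0 ys A : (0 <= M ys A)%E.
Proof. by rewrite /mechanism /pushforward. Qed.

Lemma mechanismT ys : M ys setT = 1%E.
Proof. by rewrite /mechanism /pushforward preimage_setT probability_setT. Qed.

Lemma mechanism_fin_num ys A : measurable A -> M ys A \is a fin_num.
Proof.
move=> mA; apply: fin_num_measure.
rewrite -[X in measurable X]setTI.
by apply: (measurable_fun_pair2 ys measurable_noisy).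
Qed.

(** The value at [ys] is the [Q]-measure of the section at [ys] of one measurable subset of
    [(K * S) * O], and such section measures are measurable in [ys]. *)
Lemma measurable_mechanism A : measurable A -> measurable_fun setT (M ^~ A).
Proof.
move=> mA; have mE : measurable ((fun z => vadd (F z.1) (eps z.2)) @^-1` A).
  by rewrite -[X in measurable X]setTI; exact: measurable_noisy.
rewrite (_ : M ^~ A = Q \o xsection ((fun z => vadd (F z.1) (eps z.2)) @^-1` A)).
  exact: measurable_fun_xsection.
by apply/funext => ys /=; rewrite xsectionE.
Qed.

Lemma measurable_mechanism_density A y (q : S -> R) :
  measurable A -> measurable_fun setT q ->
  measurable_fun setT (fun s => M (y, s) A * (q s)%:E)%E.
Proof.
move=> mA mq; apply: emeasurable_funM; last exact/measurable_EFinP.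
exact: (measurable_fun_pair2 y (measurable_mechanism mA)).
Qed.

(** With [A] and [y] fixed, factorization says that the latent variable, restricted to [A] and label
    [y], has a Lebesgue density; the transfer of integrals along the projection to [s] then
    applies. *)
Lemma factorizes_integral (K_discrete : forall A : set K, measurable A)
    (p : K -> R) (q : K -> S -> R) (P : probability joint R) (A : set X)
    (y : K) (B : set S) (phi : S -> \bar R) :
    factorizes M p q P -> 0 < p y -> positive_density (q y) ->
    measurable A -> measurable B ->
    measurable_fun setT phi -> (forall s, 0 <= phi s)%E ->
  (\int[P]_(w in A `*` [set y] `*` B) phi w.2 =
   \int[lebesgue_tuple R n]_(s in B)
     (phi s * ((p y)%:E * (M (y, s) A * (q y s)%:E))))%E.
Proof.
move=> Pf p0 [mq q0 _] mA mB mphi phi0.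
(* The rectangle is a slab with free latent variable, cut by a preimage under the projection to
   [s]. *)
have XE C : A `*` [set y] `*` C = (A `*` [set y] `*` setT) `&` snd @^-1` C.
  by apply/seteqP; split => [[[x z] s] /= [[? ?] ?]|[[x z] s] /= [[[? ?] _] ?]].
have mMq := measurable_mechanism_density y mA mq.
have Mq0 s : (0 <= M (y, s) A * (q y s)%:E)%E.
  by rewrite mule_ge0 ?mechanism_ge0 ?lee_fin ?ltW.
rewrite XE; apply: ge0_integral_pushforward_density => //.
- by do 2 apply: measurableX => //.
- exact: measurable_funeM.
- by move=> s; rewrite mule_ge0// lee_fin ltW.
- by move=> s; rewrite !fin_numM// mechanism_fin_num.
- move=> C mC; rewrite -XE; apply: (eq_trans (Pf _ y _ mA mC)).
  rewrite ge0_integralZl_EFin ?ltW//; exact: measurable_funTS.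
Qed.

End mechanism.

(** * Decomposition of the risk over labels *)

Section risk.
Context (R : realType) (d n : nat) (dK : measure_display) (K : measurableType dK).
Hypotheses (K_finite : finite_set [set: K])
  (K_discrete : forall A : set K, measurable A).

Local Notation X := (d.-tuple R).
Local Notation S := (n.-tuple R).
Local Notation joint := (X * K * S)%type.
Implicit Types (P : probability joint R) (f : R.-pker X ~> K) (y : K).

Definition label_event y : set joint := setT `*` [set y] `*` setT.

Lemma measurable_label_event y : measurable (label_event y).
Proof. by do 2 apply: measurableX => //. Qed.

Lemma measurable_loss_label f y :
  measurable_fun setT (fun x => - lne (f x [set y]))%E.
Proof.
apply: measurableT_comp => //; apply: (measurableT_comp (@measurable_lne R)).
exact: measurable_kernel.
Qed.

Lemma loss_ge0 f x y : (0 <= - lne (f x [set y]))%E.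
Proof.
rewrite oppe_ge0 lne_le0 -(prob_kernel (s := f) x).
by apply: le_measure; rewrite ?inE.
Qed.

Lemma partition_label_event (s : seq K) : [set: K] = [set` s] ->
  [set: joint] = \big[setU/set0]_(y <- s) label_event y.
Proof.
move=> sT; rewrite -bigcup_seq; apply/seteqP; split=> // w _.
by exists w.1.2; [rewrite -sT|].
Qed.

Lemma trivIset_label_event (D : set K) : trivIset D label_event.
Proof. by move=> y z _ _ [w [[[_ <-] _] [[_ <-] _]]]. Qed.

Lemma integral_label_event (s : seq K) P (h : joint -> \bar R) :
    uniq s -> [set: K] = [set` s] ->
    measurable_fun setT h -> (forall w, 0 <= h w)%E ->
  (\int[P]_w h w = \sum_(y <- s) \int[P]_(w in label_event y) h w)%E.
Proof.
move=> us sT mh h0; rewrite [in LHS](partition_label_event sT).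
rewrite (ge0_integral_bigsetU P measurable_label_event us) //.
- exact: trivIset_label_event.
- exact: measurable_funTS.
Qed.

Lemma measurable_loss f :
  measurable_fun setT (fun z : X * K => - lne (f z.1 [set z.2]))%E.
Proof.
apply: (measurable_fun_finite_choice K_finite K_discrete (k := snd)
  (F := fun y (z : X * K) => (- lne (f z.1 [set y]))%E)) => // y.
exact: (measurableT_comp (measurable_loss_label f y)).
Qed.

Lemma riskE P f : risk P f = (\int[P]_w - lne (f w.1.1 [set w.1.2]))%E.
Proof.
rewrite /risk ge0_integral_pushforward//; first exact: measurable_loss.
by move=> z _; exact: loss_ge0.
Qed.

Lemma risk_ge0 P f : (0 <= risk P f)%E.
Proof. by rewrite riskE; apply: integral_ge0 => z _; exact: loss_ge0. Qed.

(** On each label event the random label may be replaced by the constant [y], so each summand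
    integrates a function of the positive sample alone. *)
Lemma risk_sum (s : seq K) P f : uniq s -> [set: K] = [set` s] ->
  risk P f =
  (\sum_(y <- s) \int[P]_(w in label_event y) - lne (f w.1.1 [set y]))%E.
Proof.
move=> us sT; rewrite riskE (integral_label_event P us sT); first last.
- by move=> w; exact: loss_ge0.
- exact: (measurableT_comp (measurable_loss f) measurable_fst).
by apply: eq_bigr => y _; apply: eq_integral => w /[!inE] -[[_ /= <-] _].
Qed.

End risk.

(** * Change of measure from an environment to a PID *)

Section reweighting.
Context (R : realType) (d n : nat) (dK dO : measure_display)
  (K : measurableType dK) (O : measurableType dO) (Q : probability O R)
  (eps : {RV Q >-> d.-tuple R}) (F : {mfun (K * n.-tuple R)%type >-> d.-tuple R}).
Hypotheses (K_finite : finite_set [set: K])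
  (K_discrete : forall A : set K, measurable A).

Local Notation X := (d.-tuple R).
Local Notation S := (n.-tuple R).
Local Notation joint := (X * K * S)%type.
Local Notation M := (mechanism F eps).

Lemma label_event_probability (p : K -> R) (q : K -> S -> R)
    (P : probability joint R) y :
  factorizes M p q P -> positive_density (q y) ->
  P (label_event y) = (p y)%:E.
Proof.
move=> Pf [_ _ q1]; apply: (eq_trans (Pf _ y _ measurableT measurableT)).
by under eq_integral do rewrite mechanismT mul1e; rewrite q1 mule1.
Qed.

Variables (p : K -> R) (q : K -> S -> R) (P : probability joint R)
  (p' : K -> R) (r : S -> R).
Hypotheses (p0 : forall y, 0 < p y) (q0 : forall y, positive_density (q y))
  (Pf : factorizes M p q P) (p'0 : forall y, 0 < p' y) (r0 : positive_density r).

(** This is the Radon-Nikodym density, with respect to [P], of the PID with label weights [p'] and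
    latent density [r]; the common mechanism cancels. *)
Definition label_ratio (y : K) (s : S) : R := p' y / p y * (r s / q y s).

Lemma label_ratio_ge0 y s : 0 <= label_ratio y s.
Proof.
have [[_ q_gt0 _] [_ r_gt0 _]] := (q0 y, r0).
by rewrite /label_ratio mulr_ge0// divr_ge0// ltW.
Qed.

Lemma measurable_label_ratio y : measurable_fun setT (label_ratio y).
Proof.
have [[mq q_gt0 _] [mr r_gt0 _]] := (q0 y, r0).
apply: measurable_funM => //; apply: measurable_funM => //.
(* Since [q y] is positive, its inverse is a real power, whose measurability is known. *)
rewrite (_ : (fun s => _) = (fun s => q y s `^ (-1))); last first.
  by apply/funext => s; rewrite powR_inv1// ltW.
apply: (measurableT_comp (f := fun x : R => x `^ (-1)) _ mq).
exact: measurable_powR.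
Qed.

Let h (w : joint) : \bar R := (label_ratio w.1.2 w.2)%:E.

Let mh : measurable_fun setT h.
Proof.
apply/measurable_EFinP.
apply: (measurable_fun_finite_choice K_finite K_discrete
  (k := fun w : joint => w.1.2) (F := fun y (w : joint) => label_ratio y w.2)).
  exact: (measurableT_comp measurable_snd measurable_fst).
by move=> y; exact: (measurableT_comp (measurable_label_ratio y) measurable_snd).
Qed.

Let h0 w : (0 <= h w)%E.
Proof. by rewrite lee_fin label_ratio_ge0. Qed.

Lemma integral_label_ratio A y B : measurable A -> measurable B ->
  (\int[P]_(w in A `*` [set y] `*` B) h w =
   (p' y)%:E * \int[lebesgue_tuple R n]_(s in B) (M (y, s) A * (r s)%:E))%E.
Proof.
move=> mA mB; have [[_ q_gt0 _] [mr r_gt0 _]] := (q0 y, r0).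
transitivity (\int[P]_(w in A `*` [set y] `*` B) (label_ratio y w.2)%:E)%E.
  by apply: eq_integral => w /[!inE] -[[_ /= yE] _]; rewrite /h yE.
rewrite (factorizes_integral K_discrete (phi := fun s => (label_ratio y s)%:E) Pf)//.
- rewrite -ge0_integralZl_EFin ?ltW//; first last.
  + apply: measurable_funTS; exact: measurable_mechanism_density.
  + by move=> s _; rewrite mule_ge0 ?mechanism_ge0 ?lee_fin ?ltW.
  (* The mechanism takes finite values, so the cancellation of [p y] and [q y s] takes place in the
     reals. *)
  apply: eq_integral => s _; rewrite -(fineK (mechanism_fin_num eps F (y, s) mA)).
  rewrite -!EFinM; congr (_%:E); rewrite /label_ratio.
  by field; rewrite !gt_eqF.
- by apply/measurable_EFinP; exact: measurable_label_ratio.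
- by move=> s; rewrite lee_fin label_ratio_ge0.
Qed.

(** The ratio integrates to the sum of [p'], which is 1, so it is the density of a probability; its
    values on rectangles are those required of the PID. *)
Lemma reweighting (s : seq K) : uniq s -> [set: K] = [set` s] ->
    \sum_(y <- s) p' y = 1 ->
  exists P' : probability joint R, factorizes M p' (fun=> r) P' /\
    forall (E : set joint) (phi : joint -> \bar R), measurable E ->
      measurable_fun setT phi -> (forall w, 0 <= phi w)%E ->
    (\int[P']_(w in E) phi w =
     \int[P]_(w in E) (phi w * (label_ratio w.1.2 w.2)%:E))%E.
Proof.
move=> us sT p'1.
have h1 : (\int[P]_w h w = 1)%E.
  rewrite (integral_label_event K_discrete P us sT mh h0).
  transitivity (\sum_(y <- s) (p' y)%:E)%E; last by rewrite sumEFin p'1.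
  apply: eq_bigr => y _; rewrite integral_label_ratio//.
  have [_ _ r1] := r0.
  by under eq_integral do rewrite mechanismT mul1e; rewrite r1 mule1.
have [P' P'E] := density_probability mh h0 h1.
exists P'; split=> [A y B mA mB|E phi mE mphi phi0].
  by rewrite P'E integral_label_ratio.
rewrite -[E in LHS]setTI.
apply: (ge0_integral_pushforward_density (phi := id) (g := h)) => //.
by move=> B mB; rewrite setTI; exact: P'E.
Qed.

End reweighting.

(** * The model that ignores the positive sample *)

Section constant_model.
Context (R : realType) (d n : nat) (dK : measure_display) (K : measurableType dK).
Hypotheses (K_finite : finite_set [set: K])
  (K_discrete : forall A : set K, measurable A).

Local Notation X := (d.-tuple R).
Local Notation S := (n.-tuple R).
Local Notation joint := (X * K * S)%type.

Lemma marginal_model (P : probability joint R) :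
  exists g : R.-pker X ~> K, forall x y, g x [set y] = P (label_event y).
Proof.
have mlabel : measurable_fun setT (fun w : joint => w.1.2).
  exact: (measurableT_comp measurable_snd measurable_fst).
pose mX := isMeasurableFun.Build _ _ _ _ _ mlabel.
pose label : {mfun joint >-> K} := HB.pack (fun w : joint => w.1.2) mX.
pose m : pprobability K R := distribution P label.
exists (kprobability (measurable_cst m : measurable_fun [set: X] _)) => x y.
rewrite /kprobability/= /distribution /pushforward; congr (P _).
by apply/seteqP; split => [w <-|w [[_ <-] _]].
Qed.

(** The loss of the constant model is [- ln (p y)] throughout the event of label [y], so its risk is
    the entropy of the label. *)
Lemma risk_marginal_model (s : seq K) (P : probability joint R) (p : K -> R) :
    uniq s -> [set: K] = [set` s] -> (forall y, 0 < p y) ->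
    (forall y, P (label_event y) = (p y)%:E) ->
  exists g : R.-pker X ~> K, risk P g = (\sum_(y <- s) p y * - ln (p y))%:E.
Proof.
move=> us sT p0 Pp; have [g gE] := marginal_model P; exists g.
rewrite (risk_sum K_finite K_discrete P g us sT) -sumEFin.
apply: eq_bigr => y _.
under eq_integral do rewrite gE Pp lne_EFin//.
transitivity (- (ln (p y))%:E * P (label_event y))%E.
  exact: integral_cst (measurable_label_event K_discrete y) _.
by rewrite Pp muleC EFinM EFinN.
Qed.

End constant_model.

(** * Entropy of concentrated label weights *)

Section entropy.
Context (R : realType).
Implicit Types a u : R.

(** This is [ln t <= t - 1] at [t = a^-1], multiplied by [a]. *)
Lemma xlnx_le a : 0 < a -> a * - ln a <= 1 - a.
Proof.
move=> a0; rewrite -lnV ?posrE//.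
have : ln (1 + (a^-1 - 1)) <= a^-1 - 1.
  by apply: le_ln1Dx; rewrite ltrBrDr addNr invr_gt0.
rewrite addrC subrK => /(ler_wpM2l (ltW a0)).
by rewrite mulrBr mulfV ?gt_eqF// mulr1.
Qed.

(** Multiply [ln u^-1 < u^-1] by [2 * u ^+ 2]. Taking a square as the weight makes the bound linear
    in [u]. *)
Lemma sqr_lnsqr_le u : 0 < u -> u ^+ 2 * - ln (u ^+ 2) <= 2 * u.
Proof.
move=> u0; have : ln u^-1 < u^-1 by apply: ln_sublinear; rewrite invr_gt0.
rewrite lnV ?posrE// lnXn// => /ltW lnu.
have -> : u ^+ 2 * - (ln u *+ 2) = 2 * u ^+ 2 * - ln u by ring.
have -> : 2 * u = 2 * u ^+ 2 * u^-1 by field; rewrite gt_eqF.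
by rewrite ler_wpM2l// mulr_ge0// exprn_ge0// ltW.
Qed.

End entropy.

(** Each of the [k] labels other than [y0] receives [u ^+ 2], and [y0] receives the rest. *)
Lemma concentrated_weights (R : realType) (K : eqType) (s : seq K) (y0 : K)
    (u : R) (k := count (predC1 y0) s) :
    uniq s -> y0 \in s -> 0 < u -> u * (2 * k.+1%:R) <= 1 ->
  exists p : K -> R, [/\ forall y, 0 < p y, \sum_(y <- s) p y = 1,
    2^-1 <= p y0 & \sum_(y <- s) p y * - ln (p y) <= 3 * k%:R * u].
Proof.
move=> us ys u0; rewrite -(natr1 k).
have : 0 <= k%:R :> R by exact: ler0n.
have [c kE] : exists c : R, k%:R = c by exists k%:R.
rewrite kE => c0 uk; rewrite /k in kE.
have u1 : u <= 1 by nra.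
have uu : u ^+ 2 <= u by rewrite expr2; nra.
(* This keeps the weight of [y0] at least one half. *)
have uuk : u ^+ 2 * c <= 2^-1 by nra.
pose p y := if y == y0 then 1 - u ^+ 2 * c else u ^+ 2.
have pE (f : R -> R) : \sum_(y <- s) f (p y) =
    f (1 - u ^+ 2 * c) + f (u ^+ 2) * c.
  rewrite (bigD1_seq y0)//= {1}/p eqxx; congr (_ + _).
  rewrite (eq_bigr (fun=> f (u ^+ 2))); last first.
    by move=> y /negbTE yy0; rewrite /p yy0.
  by rewrite big_const_seq iter_addr_0 -mulr_natr -kE.
exists p; split.
- by move=> y; rewrite /p; case: ifP => _; [lra|rewrite exprn_gt0].
- by rewrite (pE id); ring.
- by rewrite /p eqxx; lra.
(* The label [y0] contributes at most [u ^+ 2 * c <= u * c], and the others together at most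
   [2 * u * c], whence the constant 3. *)
- rewrite (pE (fun x => x * - ln x)).
  have := @xlnx_le R (1 - u ^+ 2 * c) ltac:(lra).
  have := ler_wpM2r c0 (sqr_lnsqr_le u0).
  have : u ^+ 2 * c <= u * c by rewrite ler_wpM2r.
  lra.
Qed.

(** * Vanishing of the risk in every environment *)

Section zero_risk.
Context (R : realType) (d n : nat) (dK dO : measure_display)
  (K : measurableType dK) (O : measurableType dO) (Q : probability O R)
  (eps : {RV Q >-> d.-tuple R}) (F : {mfun (K * n.-tuple R)%type >-> d.-tuple R}).
Hypotheses (K_finite : finite_set [set: K])
  (K_discrete : forall A : set K, measurable A).

Local Notation X := (d.-tuple R).
Local Notation S := (n.-tuple R).
Local Notation joint := (X * K * S)%type.
Local Notation M := (mechanism F eps).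

Variables (f : R.-pker X ~> K) (P : probability joint R) (p : K -> R)
  (q : K -> S -> R).
Hypotheses (f_argmin : forall P, PID M P -> risk_argmin P f)
  (p0 : forall y, 0 < p y) (q0 : forall y, positive_density (q y))
  (Pf : factorizes M p q P).

(** The comparison PID uses the latent density [q y] for all labels, so on the event of label [y]
    the density ratio is the constant [p' y / p y]. *)
Lemma label_loss_le (s : seq K) (p' : K -> R) y :
    uniq s -> [set: K] = [set` s] ->
    (forall z, 0 < p' z) -> \sum_(z <- s) p' z = 1 ->
  ((p' y / p y)%:E * \int[P]_(w in label_event y) - lne (f w.1.1 [set y]) <=
   (\sum_(z <- s) p' z * - ln (p' z))%:E)%E.
Proof.
move=> us sT p'0 p'1.
have [P' [P'f intP']] :=
  reweighting K_finite K_discrete p0 q0 Pf p'0 (q0 y) us sT p'1.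
have [g gE] := risk_marginal_model K_finite K_discrete us sT p'0
  (fun z => label_event_probability (y := z) P'f (q0 y)).
rewrite -gE; apply: le_trans (f_argmin _ g); last first.
  by exists p', (q y); split.
have ml : measurable_fun setT (fun w : joint => - lne (f w.1.1 [set y]))%E.
  apply: (measurableT_comp (measurable_loss_label K_discrete f y)).
  exact: (measurableT_comp measurable_fst measurable_fst).
rewrite (risk_sum K_finite K_discrete P' f us sT).
have ys : y \in s by have : [set: K] y by []; rewrite sT.
(* The losses on the other labels are nonnegative and are dropped. *)
rewrite (bigD1_seq y)//=; apply: (@le_trans _ _
    (\int[P']_(w in label_event y) - lne (f w.1.1 [set y]))%E); last first.
  rewrite leeDl// sume_ge0// => z _; apply: integral_ge0 => w _.
  exact: loss_ge0.
rewrite intP' //; last 2 first.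
- exact: measurable_label_event.
- by move=> w; exact: loss_ge0.
rewrite le_eqVlt; apply/orP; left; apply/eqP.
rewrite -ge0_integralZl_EFin; last 4 first.
- exact: measurable_label_event.
- by move=> w _; exact: loss_ge0.
- exact: measurable_funTS.
- by rewrite divr_ge0// ltW.
have [_ q_gt0 _] := q0 y.
apply: eq_integral => w /[!inE] -[[_ /= ->] _].
by rewrite /label_ratio divff ?gt_eqF// mulr1 muleC.
Qed.

Lemma label_loss_eq0 y :
  (\int[P]_(w in label_event y) - lne (f w.1.1 [set y]) = 0)%E.
Proof.
have [s0 s0T] : exists s : seq K, [set: K] = [set` s] by exact/finite_seqP.
pose s := undup s0; have us : uniq s := undup_uniq s0.
have sT : [set: K] = [set` s].
  by rewrite s0T; apply/seteqP; split => z /=; rewrite mem_undup.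
have ys : y \in s by have : [set: K] y by []; rewrite sT.
set I := (\int[P]_(w in _) _)%E.
have I0 : (0 <= I)%E by apply: integral_ge0 => w _; exact: loss_ge0.
pose k := count (predC1 y) s.
have Iu u : 0 < u -> u * (2 * k.+1%:R) <= 1 ->
    (I <= (6 * p y * k%:R * u)%:E)%E.
  move=> u0 uk.
  have [p' [p'0 p'1 p'y p'ln]] := concentrated_weights us ys u0 uk.
  have := label_loss_le y us sT p'0 p'1.
  rewrite -lee_pdivlMl ?divr_gt0// => /le_trans; apply.
  rewrite -EFinM lee_fin invf_div.
  (* Here [p' y >= 2^-1] enters; with the entropy bound [3 * k%:R * u] it gives the constant 6. *)
  have : p y / p' y <= 2 * p y.
    rewrite ler_pdivrMr//; have := p0 y; nra.
  have k0 : 0 <= k%:R :> R by exact: ler0n.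
  have := divr_gt0 (p0 y) (p'0 y); have := p0 y.
  move=> py pp' le2.
  apply: (@le_trans _ _ (p y / p' y * (3 * k%:R * u))).
    by rewrite ler_wpM2l// ltW.
  apply: (@le_trans _ _ (2 * p y * (3 * k%:R * u))).
    by rewrite ler_wpM2r// !mulr_ge0// ltW.
  by rewrite le_eqVlt; apply/orP; left; apply/eqP; ring.
apply/eqP; rewrite eq_le I0 andbT; apply/lee_addgt0Pr => e e0; rewrite add0e.
pose C := 6 * p y * k%:R.
have C0 : 0 <= C by rewrite /C !mulr_ge0// ltW.
(* The first term makes [u] admissible for the concentrated weights, the second gives [C * u <= e].
   The divisor [C + 1] stays positive when [y] is the only label and [C] is 0. *)
pose u := Num.min (2 * k.+1%:R)^-1 (e / (C + 1)).
have u0 : 0 < u.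
  by rewrite lt_min invr_gt0 mulr_gt0//= divr_gt0// ltr_wpDl.
apply: (le_trans (Iu u u0 _)).
  by rewrite -ler_pdivlMr ?mulr_gt0// mul1r ge_min lexx.
rewrite lee_fin -/C; apply: (@le_trans _ _ (C * (e / (C + 1)))).
  by rewrite ler_wpM2l// ge_min lexx orbT.
by rewrite mulrA ler_pdivrMr ?ltr_wpDl//; nra.
Qed.

Lemma risk_eq0 : risk P f = 0%E.
Proof.
have [s0 s0T] : exists s : seq K, [set: K] = [set` s] by exact/finite_seqP.
rewrite (@risk_sum _ _ _ _ _ K_finite K_discrete (undup s0))//.
- by apply: big1 => y _; exact: label_loss_eq0.
- exact: undup_uniq.
- by rewrite s0T; apply/seteqP; split => z /=; rewrite mem_undup.
Qed.

End zero_risk.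

Theorem theorem3p4 (R : realType) (d n : nat)
  (dK : measure_display) (K : measurableType dK)
  (K_finite : finite_set [set: K]) (K_discrete : forall A : set K, measurable A)
  (dO : measure_display) (O : measurableType dO) (Q : probability O R)
  (eps : {RV Q >-> d.-tuple R})
  (F : {mfun (K * n.-tuple R)%type >-> d.-tuple R})
  (Finv : d.-tuple R -> K * n.-tuple R)
  (F_inj : injective F) (FK : cancel F Finv)
  (F_invertible : invertible_mechanism F Finv eps)
  (fstar : R.-pker (d.-tuple R) ~> K)
  (fstar_PID : forall P, PID (mechanism F eps) P -> risk_argmin P fstar) :
  minimax_optimal (env (mechanism F eps)) fstar.
Proof.
move=> g; apply: ge_ereal_sup => _ [P [p [q [p0 q0 Pf]]] <-].
rewrite (risk_eq0 K_finite K_discrete fstar_PID p0 q0 Pf).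
apply: (le_trans (risk_ge0 K_finite K_discrete P g)).
(* The supremum over an empty family would be [-oo]; the environment [P] at hand shows that the
   worst risk of [g] is at least [risk P g], hence nonnegative. *)
by apply: ereal_sup_ubound; exists P => //; exists p, q; split.
Qed.
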